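(* Let $a\in[\pi/3,2\pi/5)$ and put $$h_1(x):=\frac{6\pi^2}{(2\pi-5a)^2}\cos\frac{\pi\sqrt{10}\,(\pi-x)}{2\pi-5a},\qquad e_1(x):=\cos\frac{2\pi(2x-3a)}{2\pi-5a}+\cos\frac{\pi(2x-3a)}{2\pi-5a}.$$ Then $$M_{h_1}e_1(x)=-e_1(x),\quad \frac{3a}2<x<\pi-a,\qquad\text{and}\qquad \int_{3a/2}^{\pi-a}e_1(x)\,dx=0.$$
   Context: For $h\in L_2(5a/2,\pi)$ define $$K_h(x)=\int_x^\pi h(\tau)\,d\tau,\qquad M_hf(x)=\int_{3a/2}^{\pi-x+a/2}K_h\Big(x+t-\frac a2\Big)f(t)\,dt,\quad \frac{3a}2<x<\pi-a,$$ an integral operator in $L_2(3a/2,\pi-a)$. Here $h_1$ is considered on $(5a/2,\pi)$ and $e_1$ on $(3a/2,\pi-a)$. *)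

(* Defs.v *)
From mathcomp Require Import all_boot all_order all_algebra.
From mathcomp Require Import all_classical all_reals all_analysis.

Set Implicit Arguments.
Unset Strict Implicit.
Unset Printing Implicit Defensive.

Import Order.TTheory GRing.Theory Num.Theory.
Import numFieldNormedType.Exports.

Local Open Scope classical_set_scope.
Local Open Scope ring_scope.

(* Square-integrable functions on (5a/2, pi) and on (3a/2, pi - a) are
   represented by total functions R -> R.  For 3a/2 < x < pi - a, [Kop h] and
   [Mop a h f x] below only use the values of h on [5a/2, pi] and those of f on
   [3a/2, pi - a]; moreover 3a/2 < pi - x + a/2 then, so that the integral over
   a set in [Mop] agrees with the oriented one. *)

Definition Kop (R : realType) (h : R -> R) (x : R) : R :=
  \int[lebesgue_measure]_(tau in `[x, pi]) h tau.

Definition Mop (R : realType) (a : R) (h f : R -> R) (x : R) : R :=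
  \int[lebesgue_measure]_(t in `[3 * a / 2, pi - x + a / 2])
    (Kop h (x + t - a / 2) * f t).

Definition h1 (R : realType) (a : R) (x : R) : R :=
  6 * pi ^+ 2 / (2 * pi - 5 * a) ^+ 2 *
    cos (pi * Num.sqrt 10 * (pi - x) / (2 * pi - 5 * a)).

Definition e1 (R : realType) (a : R) (x : R) : R :=
  cos (2 * pi * (2 * x - 3 * a) / (2 * pi - 5 * a)) +
  cos (pi * (2 * x - 3 * a) / (2 * pi - 5 * a)).

(* Main.v *)
Require Import Defs.
From mathcomp Require Import all_boot all_order all_algebra.
From mathcomp Require Import all_classical all_reals all_analysis.
From mathcomp Require Import ring lra.

Import Order.TTheory GRing.Theory Num.Theory.
Import numFieldNormedType.Exports.

Local Open Scope classical_set_scope.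
Local Open Scope ring_scope.

(** Put [L = (2 * pi - 5 * a) / 2], [s = x - 3 * a / 2] and [y = L - s], the
length of the range of integration in [Mop]. Integrating [h1] once gives the
sine kernel [Kop (h1 a) (pi - z) = 3 * pi / (sqrt 10 * L) * sin (omega * z)]
for [0 <= z], with [omega = sqrt 10 * pi / (2 * L)] ([Kop_h1]), and the
argument of this kernel in [Mop] is [pi] minus the distance from [t] to the
right end of the range. So [Mop a (h1 a)] convolves, over a range of length
[y], a sine of frequency [omega] with the two cosines of [e1], which start at
the left end of the range and have frequencies [2 * pi / L] and [pi / L]. Up
to the factor [omega ^+ 2 - b ^+ 2], the convolution of [sin (omega * u)] and
[cos (b * u)] at [y] is [omega * (cos (b * y) - cos (omega * y))]
([Rintegral_sin_cos_conv]).

The square root of 10 is what makes the two results fit together: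
[omega ^+ 2 = 5/2 * (pi / L) ^+ 2] is the midpoint of the squares
[4 * (pi / L) ^+ 2] and [(pi / L) ^+ 2] of the frequencies of [e1]. The two
denominators [omega ^+ 2 - b ^+ 2] are therefore opposite, the terms in
[cos (omega * y)] cancel, and the factor [6] in [h1] normalizes what remains to
[cos (pi * y / L) - cos (2 * pi * y / L)]. Replacing [y] by [L - s] changes
the sign of [cos (pi * y / L)] only, which leaves [- e1 a x]. The mean of [e1]
vanishes because each of its cosines runs over an integral number of half
periods, from an extremum to an extremum. *)

Section trigonometric_integrals.
Variable R : realType.
Local Notation mu := (@lebesgue_measure R).
Implicit Types (f F : R -> R) (b c d p q t u v w : R).

Lemma is_derive_continuous f F :
  (forall t : R, is_derive t 1 F (f t)) -> continuous F.
Proof.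
move=> dF t; apply: differentiable_continuous; apply/derivable1_diffP.
exact: (@ex_derive _ _ _ _ _ _ _ (dF t)).
Qed.

Lemma Rintegral_FTC2 f F u v : u <= v -> continuous f ->
  (forall t : R, is_derive t 1 F (f t)) ->
  \int[mu]_(t in `[u, v]) f t = F v - F u.
Proof.
move=> uv cf dF; move: uv; rewrite le_eqVlt => /predU1P[->|uv].
  by rewrite set_itv1 Rintegral_set1 subrr.
have cF := is_derive_continuous _ _ dF.
rewrite /Rintegral (@continuous_FTC2 _ f F)//.
- exact: continuous_subspaceT.
- split; first by move=> t _; exact: (@ex_derive _ _ _ _ _ _ _ (dF t)).
  + by apply: cvg_at_right_filter; exact: cF.
  + by apply: cvg_at_left_filter; exact: cF.
- by move=> t _; rewrite derive1E; exact: (@derive_val _ _ _ _ _ _ _ (dF t)).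
Qed.

Lemma is_derive_affine p q t : is_derive t 1 (fun x : R => p * x + q) p.
Proof. by apply: is_derive_eq; rewrite /GRing.scale/= mulr1 addr0. Qed.

Lemma is_derive_sin_affine p q t :
  is_derive t 1 (fun x : R => sin (p * x + q)) (p * cos (p * t + q)).
Proof.
have dA := is_derive_affine p q t; rewrite mulrC.
exact: (@is_derive1_comp _ sin _ t _ _ (is_derive_sin _) dA).
Qed.

Lemma is_derive_cos_affine p q t :
  is_derive t 1 (fun x : R => cos (p * x + q)) (- (p * sin (p * t + q))).
Proof.
have dA := is_derive_affine p q t; rewrite mulrC -mulNr.
exact: (@is_derive1_comp _ cos _ t _ _ (is_derive_cos _) dA).
Qed.

Lemma continuous_sin_affine p q : continuous (fun t : R => sin (p * t + q)).
Proof. exact: is_derive_continuous _ _ (is_derive_sin_affine p q). Qed.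

Lemma continuous_cos_affine p q : continuous (fun t : R => cos (p * t + q)).
Proof. exact: is_derive_continuous _ _ (is_derive_cos_affine p q). Qed.

Lemma continuous_sin_cos_conv w b c d :
  continuous (fun t : R => sin (w * (d - t)) * cos (b * (t - c))).
Proof.
under eq_fun => t.
  rewrite (_ : w * (d - t) = - w * t + w * d); last by ring.
  rewrite (_ : b * (t - c) = b * t + - (b * c)); last by ring.
  over.
move=> t; apply: cvgM.
- exact: continuous_sin_affine.
- exact: continuous_cos_affine.
Qed.

Lemma continuous_integrable_itv f u v :
  continuous f -> mu.-integrable `[u, v] (EFin \o f).
Proof.
move=> cf; apply: continuous_compact_integrable; first exact: segment_compact.
exact: continuous_subspaceT.
Qed.

Lemma Rintegral_cos_affine p q u v : p != 0 -> u <= v ->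
  \int[mu]_(t in `[u, v]) cos (p * t + q) =
  (sin (p * v + q) - sin (p * u + q)) / p.
Proof.
move=> p0 uv.
have dF (t : R) :
    is_derive t 1 (fun t => p^-1 * sin (p * t + q)) (cos (p * t + q)).
  have dS := is_derive_sin_affine p q t.
  by apply: is_derive_eq; rewrite /GRing.scale/= mulKf.
rewrite (Rintegral_FTC2 _ _ _ _ uv (@continuous_cos_affine p q) dF).
by field.
Qed.

(** The derivatives of [C * k] and [S * s], for the functions [S], [C], [s] and
[k] of the proof, are combinations of [S * k] and [C * s]; eliminating [C * s]
leaves [w ^+ 2 - b ^+ 2] times the integrand. *)
Lemma Rintegral_sin_cos_conv w b c d : w ^+ 2 != b ^+ 2 -> c <= d ->
  \int[mu]_(t in `[c, d]) (sin (w * (d - t)) * cos (b * (t - c))) =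
  w * (cos (b * (d - c)) - cos (w * (d - c))) / (w ^+ 2 - b ^+ 2).
Proof.
move=> wb cd; have {}wb : w ^+ 2 - b ^+ 2 != 0 by rewrite subr_eq0.
pose S t := sin (- w * t + w * d); pose C t := cos (- w * t + w * d).
pose s t := sin (b * t + - (b * c)); pose k t := cos (b * t + - (b * c)).
pose F t := (w ^+ 2 - b ^+ 2)^-1 * (w * (C t * k t) - b * (S t * s t)).
have dF (t : R) : is_derive t 1 F (sin (w * (d - t)) * cos (b * (t - c))).
  have dS : is_derive t 1 S _ := is_derive_sin_affine _ _ t.
  have dC : is_derive t 1 C _ := is_derive_cos_affine _ _ t.
  have ds : is_derive t 1 s _ := is_derive_sin_affine _ _ t.
  have dk : is_derive t 1 k _ := is_derive_cos_affine _ _ t.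
  have -> : w * (d - t) = - w * t + w * d by ring.
  have -> : b * (t - c) = b * t + - (b * c) by ring.
  apply: is_derive_eq; rewrite /GRing.scale/= -/(S t) -/(C t) -/(s t) -/(k t).
  by field.
rewrite (Rintegral_FTC2 _ _ _ _ cd (@continuous_sin_cos_conv w b c d) dF).
rewrite /F /S /C /s /k.
have -> : - w * d + w * d = 0 by ring.
have -> : b * c + - (b * c) = 0 by ring.
have -> : b * d + - (b * c) = b * (d - c) by ring.
have -> : - w * c + w * d = w * (d - c) by ring.
by rewrite !sin0 !cos0; field.
Qed.

End trigonometric_integrals.

Lemma Kop_h1 (R : realType) (a x : R) : 5 * a < 2 * pi -> x <= pi ->
  Kop (h1 a) x = 6 * pi / (Num.sqrt 10 * (2 * pi - 5 * a)) *
    sin (pi * Num.sqrt 10 / (2 * pi - 5 * a) * (pi - x)).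
Proof.
move=> ha xpi; have D0 : 2 * pi - 5 * a != 0 by rewrite subr_eq0 gt_eqF.
have p0 : pi != 0 :> R by rewrite gt_eqF// pi_gt0.
have q0 : Num.sqrt 10 != 0 :> R by rewrite gt_eqF// sqrtr_gt0.
pose w : R := pi * Num.sqrt 10 / (2 * pi - 5 * a).
have w0 : w != 0 by rewrite /w !mulf_neq0 ?invr_eq0.
(* The identity is rational in [pi], so [pi] is replaced by a variable. *)
have h1E t : h1 a t =
    6 * pi ^+ 2 / (2 * pi - 5 * a) ^+ 2 * cos (- w * t + w * pi).
  by rewrite /h1 /w; congr (_ * cos _); move: (@pi R) D0 => P D0; field.
rewrite /Kop; under eq_Rintegral do rewrite h1E.
rewrite RintegralZl//; last first.
  by apply: continuous_integrable_itv; exact: continuous_cos_affine.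
rewrite Rintegral_cos_affine ?oppr_eq0// mulNr addNr sin0 -/w.
have -> : - w * x + w * pi = w * (pi - x) by ring.
by rewrite /w; move: (@pi R) D0 p0 => P D0 p0; field; rewrite D0 p0 q0.
Qed.

Theorem proposition1 (R : realType) (a : R) (ha : pi / 3 <= a < 2 * pi / 5) :
  (forall x : R, 3 * a / 2 < x < pi - a -> Mop a (h1 a) (e1 a) x = - e1 a x) /\
  \int[lebesgue_measure]_(x in `[3 * a / 2, pi - a]) e1 a x = 0.
Proof.
have {}ha : 5 * a < 2 * pi by move: ha => /andP[_]; lra.
have D0 : 2 * pi - 5 * a != 0 by rewrite subr_eq0 gt_eqF.
have p0 : pi != 0 :> R by rewrite gt_eqF// pi_gt0.
have q0 : Num.sqrt 10 != 0 :> R by rewrite gt_eqF// sqrtr_gt0.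
have qq : Num.sqrt 10 ^+ 2 = 10 :> R by rewrite sqr_sqrtr.
(* [b] is [pi / L], the lower frequency in [e1]; [bL] says that [L] is half a
period of it. *)
pose b : R := 2 * pi / (2 * pi - 5 * a).
have b0 : b != 0 by rewrite /b !mulf_neq0 ?invr_eq0.
have e1E t : e1 a t = cos (2 * b * (t - 3 * a / 2)) + cos (b * (t - 3 * a / 2)).
  by rewrite /e1 /b; congr (cos _ + cos _); move: (@pi R) D0 => P D0; field.
have bL : b * (pi - a - 3 * a / 2) = pi.
  by rewrite /b; move: (@pi R) D0 => P D0; field.
split=> [x /andP[ax xa]|].
- pose w : R := pi * Num.sqrt 10 / (2 * pi - 5 * a).
  pose k : R := 6 * pi / (Num.sqrt 10 * (2 * pi - 5 * a)).
  pose c := 3 * a / 2; pose d := pi - x + a / 2.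
  have cd : c <= d by rewrite /c /d; lra.
  have ww : w ^+ 2 = 5 / 2 * b ^+ 2.
    by rewrite /w /b !expr_div_n !exprMn qq; move: (@pi R) D0 => P D0; field.
  have kw : k * w = 3 / 2 * b ^+ 2.
    by rewrite /k /w /b; move: (@pi R) D0 => P D0; field; rewrite D0 q0.
  have bb0 : b ^+ 2 != 0 by rewrite expf_neq0.
  have intM p : lebesgue_measure.-integrable `[c, d]
      (EFin \o (fun t => sin (w * (d - t)) * cos (p * (t - c)))).
    by apply: continuous_integrable_itv; exact: continuous_sin_cos_conv.
  have integrandE t : t <= d -> Kop (h1 a) (x + t - a / 2) * e1 a t =
      k * (sin (w * (d - t)) * cos (2 * b * (t - c)) +
           sin (w * (d - t)) * cos (b * (t - c))).
    move=> td; rewrite Kop_h1// ?e1E; last by move: td; rewrite /d; lra.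
    rewrite -/w -/k -/c -mulrDr mulrA.
    by congr (k * sin (w * _) * _); rewrite /d; field.
  have -> : Mop a (h1 a) (e1 a) x = \int[lebesgue_measure]_(t in `[c, d])
      (k * (sin (w * (d - t)) * cos (2 * b * (t - c)) +
            sin (w * (d - t)) * cos (b * (t - c)))).
    apply: eq_Rintegral => t; rewrite inE/= in_itv/= => /andP[_ td].
    exact: integrandE.
  rewrite RintegralZl//; last exact: (integrableD _ (intM _) (intM _)).
  (* [w ^+ 2] lies midway between [(2 * b) ^+ 2] and [b ^+ 2]: the denominators
  are [- (k * w)] and [k * w]. *)
  have w2b : w ^+ 2 - (2 * b) ^+ 2 = - (3 / 2 * b ^+ 2) by rewrite ww; field.
  have w1b : w ^+ 2 - b ^+ 2 = 3 / 2 * b ^+ 2 by rewrite ww; field.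
  rewrite RintegralD//.
  rewrite !Rintegral_sin_cos_conv//; first last.
  - by rewrite -subr_eq0 w2b oppr_eq0 mulf_neq0.
  - by rewrite -subr_eq0 w1b mulf_neq0.
  rewrite w2b w1b -kw e1E -/c.
  (* [d - c] is [L - s]; this shift by [L] changes the sign of the second cosine
  only. *)
  have dcE : d - c = (pi - a - 3 * a / 2) - (x - c) by rewrite /d /c; field.
  have -> : 2 * b * (d - c) = - (2 * b * (x - c)) + pi *+ 2.
    by rewrite dcE mulrBr -(mulrA 2 b (_ - _ - _)) bL addrC !mulr_natl.
  have -> : b * (d - c) = - (b * (x - c)) + pi by rewrite dcE mulrBr bL addrC.
  rewrite cosD2pi cosDpi !cosN.
  have kw0 : k * w != 0 by rewrite kw mulf_neq0.
  have [k0 w0] : k != 0 /\ w != 0.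
    by apply/andP; move: kw0; rewrite mulf_eq0 negb_or.
  by field; rewrite k0 w0.
- have uv : 3 * a / 2 <= pi - a by lra.
  under eq_Rintegral do rewrite e1E.
  have cosE p (t : R) :
      cos (p * (t - 3 * a / 2)) = cos (p * t + - (p * (3 * a / 2))).
    by rewrite mulrBr.
  under eq_Rintegral do rewrite !cosE.
  have cint p : lebesgue_measure.-integrable `[3 * a / 2, pi - a]
      (EFin \o (fun t : R => cos (p * t + - (p * (3 * a / 2))))).
    by apply: continuous_integrable_itv; exact: continuous_cos_affine.
  rewrite RintegralD//.
  have b20 : 2 * b != 0 by rewrite mulf_neq0.
  rewrite !Rintegral_cos_affine// -!mulrBr !subrr !mulr0.
  rewrite -(mulrA 2 b (_ - _ - _)) bL.
  by rewrite sin0 sinpi mulr_natl sin2pi !subr0 !mul0r addr0.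
Qed.
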